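(* Let $(TM,\lambda)$ be an EAP-space. Assume that the canonical $d$-connection $D$ is of Cartan type. Then: (a) The expression $y^b(\lambda_i^a\,\partial_\mu\lambda_{ib})$ (summed over $i$ and $b$) represents the coefficients of a nonlinear connection which coincides with the given nonlinear connection: $N^a_\mu=y^b(\lambda_i^a\,\partial_\mu\lambda_{ib})$. (b) $R^a_{\mu\nu}=P^a_{\mu c}=T^a_{bc}=0$. Consequently, $C^a_{bc}$ is symmetric (in $b,c$), $\gamma^a_{bc}=0$ and $C^a_{bc}=\widetilde C^a_{bc}=\widehat C^a_{bc}=\mathring C^a_{bc}$. (c) $\lambda_i^a{}_{\widetilde{||}b}=\lambda_i^a{}_{\widehat{||}b}=\lambda_i^a{}_{\overset{\circ}{||}b}=0$ for all $i$; $g_{ab\widetilde{||}c}=g_{ab\widehat{||}c}=g_{ab\overset{\circ}{||}c}=0$; $y^a{}_{\widetilde{||}b}=y^a{}_{\widehat{||}b}=y^a{}_{\overset{\circ}{||}b}=\delta^a_b$. (d) The $\lambda_{ia}$ are positively homogeneous of degree $0$ in $y$. Consequently, so are the $g_{ab}$. (e) $\dot\partial_bN^a_\mu=\Gamma^a_{b\mu}$ and $N^a_\mu$ is homogeneous. Consequently, $\Gamma^a_{b\mu}$ is positively homogeneous of degree $0$ in $y$. (f) $\gamma^a_{b\mu}=0$. Consequently, $\Gamma^a_{b\mu}=\mathring\Gamma^a_{b\mu}$. (g) $\mathring P^a_{\mu b}=0$.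
   Context: Let $M$ be a smooth paracompact $n$-manifold, $TM$ its tangent bundle with induced local coordinates $(x^\mu,y^a)$, and $N=(N^a_\mu(x,y))$ a given nonlinear connection on $TM$. Greek indices denote horizontal and Latin indices vertical components; both run over $1,\dots,n$; repeated indices (including the mesh index $i$) are summed. Put $\partial_\mu=\partial/\partial x^\mu$, $\dot\partial_a=\partial/\partial y^a$, $\delta_\mu=\partial_\mu-N^a_\mu\dot\partial_a$ (adapted frame $(\delta_\mu,\dot\partial_a)$ of the splitting of $T_u(TM)$, $u\in TM\setminus\{0\}$) and $R^a_{\mu\nu}=\delta_\nu N^a_\mu-\delta_\mu N^a_\nu$. $N$ is called homogeneous if $N^a_\mu$ is positively homogeneous of degree $1$ in $y$. A $d$-connection is a linear connection $D$ on $TM$ preserving by parallelism the horizontal and the vertical distribution; its coefficients $(\Gamma^\alpha_{\mu\nu},\Gamma^a_{b\nu},C^\alpha_{\mu c},C^a_{bc})$ are defined by $D_{\delta_\nu}\delta_\mu=\Gamma^\alpha_{\mu\nu}\delta_\alpha$, $D_{\delta_\nu}\dot\partial_b=\Gamma^a_{b\nu}\dot\partial_a$, $D_{\dot\partial_c}\delta_\mu=C^\alpha_{\mu c}\delta_\alpha$, $D_{\dot\partial_c}\dot\partial_b=C^a_{bc}\dot\partial_a$. Its $h$- and $v$-covariant derivatives $|$, $||$ are the components of covariant differentiation along $\delta_\mu$, $\dot\partial_c$, e.g. $X^a{}_{|\mu}=\delta_\mu X^a+X^b\Gamma^a_{b\mu}$, $X^a{}_{||c}=\dot\partial_cX^a+X^bC^a_{bc}$,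 $g_{ab||c}=\dot\partial_cg_{ab}-g_{db}C^d_{ac}-g_{ad}C^d_{bc}$. $D$ is of Cartan type if $y^a{}_{|\mu}=0$ and $y^a{}_{||c}=\delta^a_c$, equivalently $N^a_\mu=y^b\Gamma^a_{b\mu}$ and $y^bC^a_{bc}=0$. EAP-space $(TM,\lambda)$: $TM$ with $N$ and $n$ vector fields $\lambda_i=\lambda_i^\alpha\delta_\alpha+\lambda_i^a\dot\partial_a$ ($i=1,\dots,n$) defined globally on $TM$ with linearly independent horizontal parts and linearly independent vertical parts. $(\lambda_{i\alpha})$, $(\lambda_{ia})$ are the inverse matrices of $(\lambda_i^\alpha)$, $(\lambda_i^a)$. Metric: $g_{\alpha\beta}=\lambda_{i\alpha}\lambda_{i\beta}$, $g_{ab}=\lambda_{ia}\lambda_{ib}$, with inverses $g^{\alpha\beta}$, $g^{ab}$. Natural metric $d$-connection $\mathring D$: $\mathring\Gamma^\alpha_{\mu\nu}=\frac12g^{\alpha\epsilon}(\delta_\mu g_{\epsilon\nu}+\delta_\nu g_{\epsilon\mu}-\delta_\epsilon g_{\mu\nu})$, $\mathring\Gamma^a_{b\nu}=\dot\partial_bN^a_\nu+\frac12g^{ac}(\delta_\nu g_{bc}-g_{dc}\dot\partial_bN^d_\nu-g_{bd}\dot\partial_cN^d_\nu)$, $\mathring C^\alpha_{\mu c}=\frac12g^{\alpha\epsilon}\dot\partial_cg_{\mu\epsilon}$, $\mathring C^a_{bc}=\frac12g^{ad}(\dot\partial_bg_{dc}+\dot\partial_cg_{db}-\dot\partial_dg_{bc})$;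 $\mathring P^a_{\mu b}=\dot\partial_bN^a_\mu-\mathring\Gamma^a_{b\mu}$. Canonical $d$-connection $D$: $\Gamma^\alpha_{\mu\nu}=\lambda_i^\alpha\delta_\nu\lambda_{i\mu}$, $\Gamma^a_{b\nu}=\lambda_i^a\delta_\nu\lambda_{ib}$, $C^\alpha_{\mu c}=\lambda_i^\alpha\dot\partial_c\lambda_{i\mu}$, $C^a_{bc}=\lambda_i^a\dot\partial_c\lambda_{ib}$; $P^a_{\mu c}=\dot\partial_cN^a_\mu-\Gamma^a_{c\mu}$, $T^a_{bc}=C^a_{bc}-C^a_{cb}$. Contortion components: $\gamma^a_{b\mu}=\Gamma^a_{b\mu}-\mathring\Gamma^a_{b\mu}$, $\gamma^a_{bc}=C^a_{bc}-\mathring C^a_{bc}$. Dual $\widetilde D$ and symmetric $\widehat D$: $\widetilde\Gamma^\alpha_{\mu\nu}=\Gamma^\alpha_{\nu\mu}$, $\widehat\Gamma^\alpha_{\mu\nu}=\frac12(\Gamma^\alpha_{\mu\nu}+\Gamma^\alpha_{\nu\mu})$, $\widetilde\Gamma^a_{b\mu}=\widehat\Gamma^a_{b\mu}=\Gamma^a_{b\mu}$, $\widetilde C^\alpha_{\mu c}=\widehat C^\alpha_{\mu c}=C^\alpha_{\mu c}$, $\widetilde C^a_{bc}=C^a_{cb}$, $\widehat C^a_{bc}=\frac12(C^a_{bc}+C^a_{cb})$. The $v$-covariant derivatives of $\widetilde D,\widehat D,\mathring D$ are written $\widetilde{||},\widehat{||},\overset{\circ}{||}$. *)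

(* Defs.v *)
From mathcomp Require Import all_boot all_order all_algebra.
From mathcomp Require Import all_classical all_reals all_analysis.
Set Implicit Arguments.
Unset Strict Implicit.
Unset Printing Implicit Defensive.
Import Order.TTheory GRing.Theory Num.Theory.
Import numFieldNormedType.Exports.
Local Open Scope classical_set_scope.
Local Open Scope ring_scope.

(* Class C^k on a set A, used here for open A in finite-dimensional V, where
   it amounts to all iterated partial derivatives of order at most k existing
   and being continuous on A. *)
Fixpoint Ck_on (R : realType) (V W : normedModType R) (k : nat) (A : set V)
    (f : V -> W) : Prop :=
  (forall x, A x -> {for x, continuous f}) /\
  match k with
  | 0%N => True
  | k'.+1 => forall v, (forall x, A x -> derivable f x v) /\ Ck_on k' A ('D_v f)
  end.

Definition smooth_on (R : realType) (V W : normedModType R) (A : set V)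
    (f : V -> W) : Prop := forall k, Ck_on k A f.

Definition paracompact (T : topologicalType) : Prop :=
  forall C : set (set T),
    (forall U, C U -> open U) -> \bigcup_(U in C) U = setT ->
    exists D : set (set T),
      [/\ forall V, D V -> open V,
          \bigcup_(V in D) V = setT,
          forall V, D V -> exists2 U, C U & V `<=` U
        & forall x : T, exists2 W : set T,
            nbhs x W & finite_set [set V | D V /\ V `&` W !=set0]].

(* chart_fun and chart_inv are total; only their values on chart_dom and on its
   image are meaningful. *)
Record chart (R : realType) (n : nat) (T : topologicalType) := Chart {
  chart_dom : set T;
  chart_fun : T -> 'rV[R]_n;
  chart_inv : 'rV[R]_n -> T;
  chart_dom_open : open chart_dom;
  chart_img_open : open (chart_fun @` chart_dom);
  chart_funK : forall p, chart_dom p -> chart_inv (chart_fun p) = p;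
  chart_fun_continuous : forall p, chart_dom p -> {for p, continuous chart_fun};
  chart_inv_continuous :
    forall x, (chart_fun @` chart_dom) x -> {for x, continuous chart_inv} }.

Definition overlap (R : realType) (n : nat) (T : topologicalType)
    (c d : chart R n T) : set 'rV[R]_n :=
  chart_fun c @` (chart_dom c `&` chart_dom d).

Definition transition (R : realType) (n : nat) (T : topologicalType)
    (c d : chart R n T) : 'rV[R]_n -> 'rV[R]_n :=
  chart_fun d \o chart_inv c.

Record smoothManifold (R : realType) (n : nat) := SmoothManifold {
  carrier :> topologicalType;
  carrier_hausdorff : hausdorff_space carrier;
  carrier_paracompact : paracompact carrier;
  chart_index : Type;
  atlas : chart_index -> chart R n carrier;
  atlas_cover : forall p, exists c, chart_dom (atlas c) p;
  atlas_smooth : forall c d,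
    smooth_on (overlap (atlas c) (atlas d)) (transition (atlas c) (atlas d)) }.

(* Points (x, y) of TM in the coordinates induced by a chart. *)
Notation TMpt R n := ('rV[R]_n * 'rV[R]_n)%type.

(* Image of TM (slit = false) or of TM minus its zero section (slit = true)
   in the coordinates induced by the chart c. *)
Definition TMdom (R : realType) (n : nat) (M : smoothManifold R n) (slit : bool)
    (c : chart_index M) : set (TMpt R n) :=
  [set u | (chart_fun (atlas c) @` chart_dom (atlas c)) u.1 /\
           (slit -> u.2 <> 0)].

(* jac c d x a b is the partial derivative of the b-th new coordinate with
   respect to the a-th old one. *)
Definition jac (R : realType) (n : nat) (M : smoothManifold R n)
    (c d : chart_index M) (x : 'rV[R]_n) : 'M[R]_n :=
  'J (transition (atlas c) (atlas d)) x.

Definition TMtransition (R : realType) (n : nat) (M : smoothManifold R n)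
    (c d : chart_index M) (u : TMpt R n) : TMpt R n :=
  (transition (atlas c) (atlas d) u.1, u.2 *m jac c d u.1).

Definition TMoverlap (R : realType) (n : nat) (M : smoothManifold R n)
    (slit : bool) (c d : chart_index M) : set (TMpt R n) :=
  [set u | TMdom slit c u /\ overlap (atlas c) (atlas d) u.1].

(* A nonlinear connection: local functions N^a_mu (N c a mu in the chart c) with
     N'^b_nu (dx'^nu/dx^mu)
       = (dx'^b/dx^a) N^a_mu - (d^2 x'^b/dx^mu dx^k) y^k,
   so that delta_mu = (dx'^nu/dx^mu) delta'_nu. *)
Definition nonlinear_connection (R : realType) (n : nat) (M : smoothManifold R n)
    (slit : bool) (N : chart_index M -> 'I_n -> 'I_n -> TMpt R n -> R) : Prop :=
  (forall c a mu, smooth_on (TMdom slit c) (N c a mu)) /\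
  (forall c d u, TMoverlap slit c d u -> forall b mu,
     \sum_nu N d b nu (TMtransition c d u) * jac c d u.1 mu nu =
     \sum_a jac c d u.1 a b * N c a mu u -
     \sum_k 'D_(delta_mx 0 mu) (fun x => jac c d x k b) u.1 * u.2 0 k).

(* Components of the horizontal or of the vertical part of a vector field on TM,
   in the adapted frames. *)
Definition adapted_components (R : realType) (n : nat) (M : smoothManifold R n)
    (slit : bool) (X : chart_index M -> 'I_n -> TMpt R n -> R) : Prop :=
  (forall c a, smooth_on (TMdom slit c) (X c a)) /\
  (forall c d u, TMoverlap slit c d u -> forall b,
     X d b (TMtransition c d u) = \sum_a jac c d u.1 a b * X c a u).

Record EAPspace (R : realType) (n : nat) (M : smoothManifold R n) (slit : bool) :=
  EAPSpace {
  (* nlc c a mu = N^a_mu *)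
  nlc : chart_index M -> 'I_n -> 'I_n -> TMpt R n -> R;
  nlcP : nonlinear_connection slit nlc;
  (* lamh c i alpha = lambda_i^alpha,  lamv c i a = lambda_i^a *)
  lamh : chart_index M -> 'I_n -> 'I_n -> TMpt R n -> R;
  lamv : chart_index M -> 'I_n -> 'I_n -> TMpt R n -> R;
  lamhP : forall i, adapted_components slit (fun c => lamh c i);
  lamvP : forall i, adapted_components slit (fun c => lamv c i);
  lamh_free : forall c u, TMdom slit c u ->
    row_free (\matrix_(i < n, al < n) lamh c i al u);
  lamv_free : forall c u, TMdom slit c u ->
    row_free (\matrix_(i < n, a < n) lamv c i a u) }.

Section Coordinates.
Context {R : realType} {n : nat}.
Implicit Types (f : TMpt R n -> R) (u : TMpt R n) (N : 'I_n -> 'I_n -> TMpt R n -> R).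

Definition dx (mu : 'I_n) f : TMpt R n -> R := 'D_(delta_mx 0 mu, 0) f.
Definition dy (a : 'I_n) f : TMpt R n -> R := 'D_(0, delta_mx 0 a) f.
Definition dadapted N (mu : 'I_n) f : TMpt R n -> R :=
  fun u => dx mu f u - \sum_a N a mu u * dy a f u.

(* curvN N a mu nu = R^a_{mu nu} *)
Definition curvN N (a mu nu : 'I_n) : TMpt R n -> R :=
  fun u => dadapted N nu (N a mu) u - dadapted N mu (N a nu) u.

Definition pos_homogeneous (A : set (TMpt R n)) (k : nat) f : Prop :=
  forall x y (t : R), A (x, y) -> 0 < t -> f (x, t *: y) = t ^+ k * f (x, y).

Definition yfield (a : 'I_n) : TMpt R n -> R := fun u => u.2 0 a.

(* Local coefficients of a d-connection, each with its upper index first: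
   Gam_h al mu nu = Gamma^al_{mu nu},   Gam_v a b nu = Gamma^a_{b nu},
   C_h al mu c = C^al_{mu c},           C_v a b c = C^a_{bc}. *)
Record dconnection := DConnection {
  Gam_h : 'I_n -> 'I_n -> 'I_n -> TMpt R n -> R;
  Gam_v : 'I_n -> 'I_n -> 'I_n -> TMpt R n -> R;
  C_h : 'I_n -> 'I_n -> 'I_n -> TMpt R n -> R;
  C_v : 'I_n -> 'I_n -> 'I_n -> TMpt R n -> R }.
Implicit Type D : dconnection.

(* X^a_{|mu} *)
Definition hcov N D (X : 'I_n -> TMpt R n -> R) (a mu : 'I_n) : TMpt R n -> R :=
  fun u => dadapted N mu (X a) u + \sum_b X b u * Gam_v D a b mu u.

(* X^a_{||c} *)
Definition vcov D (X : 'I_n -> TMpt R n -> R) (a c : 'I_n) : TMpt R n -> R :=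
  fun u => dy c (X a) u + \sum_b X b u * C_v D a b c u.

(* g_{ab||c} *)
Definition vcov2 D (g : 'I_n -> 'I_n -> TMpt R n -> R) (a b c : 'I_n) :
    TMpt R n -> R :=
  fun u => dy c (g a b) u - \sum_d g d b u * C_v D d a c u
                          - \sum_d g a d u * C_v D d b c u.

Definition dualD D := DConnection
  (fun al mu nu => Gam_h D al nu mu) (Gam_v D) (C_h D) (fun a b c => C_v D a c b).

Definition symD D := DConnection
  (fun al mu nu u => (Gam_h D al mu nu u + Gam_h D al nu mu u) / 2)
  (Gam_v D) (C_h D)
  (fun a b c u => (C_v D a b c u + C_v D a c b u) / 2).

(* P^a_{mu c} *)
Definition Ptor N D (a mu c : 'I_n) : TMpt R n -> R :=
  fun u => dy c (N a mu) u - Gam_v D a c mu u.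

(* T^a_{bc} *)
Definition Ttor D (a b c : 'I_n) : TMpt R n -> R :=
  fun u => C_v D a b c u - C_v D a c b u.

(* For a frame lam (lam i a = lambda_i^a): coframe lam i a = lambda_{ia},
   metric lam a b = g_{ab}, imetric lam a b = g^{ab}. *)
Definition coframe (lam : 'I_n -> 'I_n -> TMpt R n -> R) (i a : 'I_n) :
    TMpt R n -> R :=
  fun u => invmx (\matrix_(j < n, b < n) lam j b u) a i.

Definition metric (lam : 'I_n -> 'I_n -> TMpt R n -> R) (a b : 'I_n) :
    TMpt R n -> R :=
  fun u => \sum_i coframe lam i a u * coframe lam i b u.

Definition imetric (lam : 'I_n -> 'I_n -> TMpt R n -> R) (a b : 'I_n) :
    TMpt R n -> R :=
  fun u => invmx (\matrix_(d < n, e < n) metric lam d e u) a b.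

Definition canonicalD N (lh lv : 'I_n -> 'I_n -> TMpt R n -> R) := DConnection
  (fun al mu nu u => \sum_i lh i al u * dadapted N nu (coframe lh i mu) u)
  (fun a b nu u => \sum_i lv i a u * dadapted N nu (coframe lv i b) u)
  (fun al mu c u => \sum_i lh i al u * dy c (coframe lh i mu) u)
  (fun a b c u => \sum_i lv i a u * dy c (coframe lv i b) u).

Definition naturalD N (lh lv : 'I_n -> 'I_n -> TMpt R n -> R) := DConnection
  (fun al mu nu u => (\sum_e imetric lh al e u *
     (dadapted N mu (metric lh e nu) u + dadapted N nu (metric lh e mu) u
      - dadapted N e (metric lh mu nu) u)) / 2)
  (fun a b nu u => dy b (N a nu) u + (\sum_c imetric lv a c u *
     (dadapted N nu (metric lv b c) u
      - \sum_d metric lv d c u * dy b (N d nu) u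
      - \sum_d metric lv b d u * dy c (N d nu) u)) / 2)
  (fun al mu c u => (\sum_e imetric lh al e u * dy c (metric lh mu e) u) / 2)
  (fun a b c u => (\sum_d imetric lv a d u *
     (dy b (metric lv d c) u + dy c (metric lv d b) u
      - dy d (metric lv b c) u)) / 2).

End Coordinates.
Arguments dconnection R n : clear implicits.

Section EAP.
Context {R : realType} {n : nat} {M : smoothManifold R n} {slit : bool}.
Implicit Types (S : EAPspace M slit) (c : chart_index M).

Definition Dcan S c := canonicalD (nlc S c) (lamh S c) (lamv S c).
Definition Dnat S c := naturalD (nlc S c) (lamh S c) (lamv S c).
Definition Ddual S c := dualD (Dcan S c).
Definition Dsym S c := symD (Dcan S c).

(* lambda_{ia} and g_{ab} *)
Definition colamv S c := coframe (lamv S c).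
Definition gv S c := metric (lamv S c).

(* gamma^a_{b mu} and gamma^a_{bc} *)
Definition contortion_h S c (a b mu : 'I_n) : TMpt R n -> R :=
  fun u => Gam_v (Dcan S c) a b mu u - Gam_v (Dnat S c) a b mu u.
Definition contortion_v S c (a b e : 'I_n) : TMpt R n -> R :=
  fun u => C_v (Dcan S c) a b e u - C_v (Dnat S c) a b e u.

Definition cartan_type S (D : chart_index M -> dconnection R n) : Prop :=
  forall c u, TMdom slit c u ->
    (forall a mu, hcov (nlc S c) (D c) yfield a mu u = 0) /\
    (forall a b, vcov (D c) yfield a b u = (a == b)%:R).

End EAP.

(* Main.v *)
(* Contracting y^b C^a_{bc} = 0 with the coframe gives y^b (d lambda_{ib} / d y^c) = 0,
   so f_i = y^b lambda_{ib} satisfies d f_i / d y^c = lambda_{ic}, and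
   N^a_mu = y^b Gamma^a_{b mu} becomes d f_i / d x^mu = lambda_{ia} N^a_mu.  Everything
   follows from the symmetry of the second derivatives of f_i: in (y, y) it gives
   the symmetry of C, whence the lambda_{ia} are constant along rays by Euler's
   argument; in (x, y) it gives d N^a_mu / d y^c = Gamma^a_{c mu}; in (x, x) it
   gives R = 0.  The natural coefficients then agree with the canonical ones
   because D is metric. *)
Require Import Defs.
From mathcomp Require Import all_boot all_order all_algebra.
From mathcomp Require Import all_classical all_reals all_analysis ring lra.
From HB Require Import structures.
Import Order.TTheory GRing.Theory Num.Theory.
Import numFieldNormedType.Exports.
Local Open Scope classical_set_scope.
Local Open Scope ring_scope.

(** [Ck_on] speaks of directional derivatives only, so the calculus behind the argument is built on
    it: equality of mixed derivatives, Fréchet differentiability of C^1 functions, and, through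
    Cramer's rule, smoothness of the lambda_{ia}, which are entries of an inverse matrix. The
    Fréchet differential enters twice: Euler's argument needs the derivative to be additive in its
    direction, and the Jacobian of a change of charts must be injective. The latter serves the one
    assertion that compares charts, that the expression in (a) is a nonlinear connection; all the
    others are identities or homogeneity statements in a single chart. They are proved on an open
    set [A] stable under positive dilations of the fibre, which covers TM and TM without its zero
    section alike. *)

(** * Directional derivatives, the mean value theorem and Schwarz's theorem *)

(** The two difference quotients coincide as functions of [h], so a derivative can be carried
    between different spaces, in particular between a line in [V] and its real parameter. *)
Lemma is_derive_line {R : realType} {U V : normedModType R} {g : U -> R} {f : V -> R}
    {y w : U} {x v : V} {d : R} :
  (forall h : R, f (h *: v + x) = g (h *: w + y)) ->
  is_derive y w g d -> is_derive x v f d.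
Proof.
move=> fg [dg gd].
have E : (fun h => h^-1 *: ((g \o shift y) (h *: w) - g y)) =
         (fun h => h^-1 *: ((f \o shift x) (h *: v) - f x)).
  apply/funext => h /=; rewrite -fg; congr (_ *: (_ - _)).
  by have := fg 0; rewrite !scale0r !add0r.
by split; [rewrite /derivable -E|rewrite -gd /derive -E].
Qed.

Section Calculus.
Context {R : realType} {V : normedModType R}.
Implicit Types (f g : V -> R) (A : set V) (x v w : V).

(** Derivability in the single direction [v] suffices: the restriction of [f] to that line is a
    function of one real variable, where derivable means differentiable and the derivative is linear
    in the direction. *)
Lemma is_derive_scale f x v (k : R) :
  derivable f x v -> is_derive x (k *: v) f (k * 'D_v f x).
Proof.
move=> dfv; pose phi (h : R) := f (h *: v + x).
have phi' : is_derive (0 : R) (1 : R) phi ('D_v f x).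
  apply: is_derive_line (derivableP dfv) => h.
  by rewrite /phi addr0 [h *: 1]mulr1.
have diffphi : differentiable phi 0 by apply: (derivable1_diffP phi 0).1.
have phik : is_derive (0 : R) k phi (k * 'D_v f x).
  apply: DeriveDef; first exact: diff_derivable.
  rewrite -(@derive_val _ _ _ _ _ _ _ phi') !deriveE //.
  by rewrite -[in LHS](mulr1 k) linearZ.
apply: is_derive_line phik => h.
by rewrite /phi addr0 scalerA.
Qed.

(** Running along the segment with parameter [s * h], [s] in the unit interval, treats both signs of
    [h] at once. *)
Lemma MVT_direction f x v (h : R) :
  (forall s : R, s \in `[0, 1] -> derivable f (x + (s * h) *: v) v) ->
  exists2 s : R, s \in `[0, 1] &
    f (x + h *: v) - f x = h * 'D_v f (x + (s * h) *: v).
Proof.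
move=> dfv.
pose phi (t : R) := f (x + (t * h) *: v).
have dphi (t : R) : t \in `[0, 1] ->
    is_derive t 1 phi (h * 'D_v f (x + (t * h) *: v)).
  move=> t01; apply: is_derive_line (is_derive_scale _ _ _ h (dfv t t01)) => s.
  by rewrite /phi [s *: 1]mulr1 mulrDl scalerDl scalerA addrCA.
have cphi : {within `[0, 1], continuous phi}.
  apply: derivable_within_continuous => t t01.
  exact: (@ex_derive _ _ _ _ _ _ _ (dphi t t01)).
have dphi' (t : R) : t \in `]0, 1[ ->
    is_derive t 1 phi (h * 'D_v f (x + (t * h) *: v)).
  by rewrite in_itv /= => /andP[? ?]; apply: dphi; rewrite in_itv/= !ltW.
have := MVT_segment ler01 dphi' cphi.
move=> [s s01].
rewrite /phi mul1r mul0r scale0r addr0 subr0 mulr1 => ?.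
by exists s.
Qed.

Lemma ball_segments {x v w : V} {d s t : R} : s \in `[0, 1] -> t \in `[0, 1] ->
  `|v| + `|w| < d -> ball x d (x + s *: v + t *: w).
Proof.
rewrite !in_itv /= => /andP[s0 s1] /andP[t0 t1].
rewrite -ball_normE /=; apply: le_lt_trans.
rewrite -addrA opprD addNKr normrN.
apply: le_trans (ler_normD _ _) _; rewrite !normrZ !ger0_norm //.
by rewrite lerD // ler_piMl.
Qed.

Lemma Ck_continuous {W : normedModType R} k A (f : V -> W) x : Ck_on k A f -> A x -> {for x, continuous f}.
Proof. by case: k => [|k] [+ _]; apply. Qed.

Lemma Ck_derivable {W : normedModType R} k A (f : V -> W) x v : Ck_on k.+1 A f -> A x -> derivable f x v.
Proof. by move=> [_ /(_ v)[+ _]]; apply. Qed.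

Lemma Ck_derive {W : normedModType R} k A (f : V -> W) v : Ck_on k.+1 A f -> Ck_on k A ('D_v f).
Proof. by move=> [_ /(_ v)[]]. Qed.

(** The mean value theorem is used in direction [v] on the increment [g] of [f] along [h *: w], then
    in direction [w] on ['D_v f]. *)
Lemma second_difference {A f x v w} {h : R} : Ck_on 2 A f ->
  (forall s t : R, s \in `[0, 1] -> t \in `[0, 1] ->
     A (x + s *: (h *: v) + t *: (h *: w))) ->
  exists s t : R, [/\ s \in `[0, 1], t \in `[0, 1] &
    f (x + h *: v + h *: w) - f (x + h *: v) - (f (x + h *: w) - f x) =
    h * (h * 'D_w ('D_v f) (x + s *: (h *: v) + t *: (h *: w)))].
Proof.
move=> fC2 inA.
have i0 : (0 : R) \in `[0, 1] by rewrite in_itv /= lexx ler01.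
have i1 : (1 : R) \in `[0, 1] by rewrite in_itv /= lexx ler01.
pose g y := f (y + h *: w) - f y.
have dg (s : R) : s \in `[0, 1] -> is_derive (x + (s * h) *: v) v g
    ('D_v f (x + (s * h) *: v + h *: w) - 'D_v f (x + (s * h) *: v)).
  move=> s01; set y := x + _.
  have Ay : A y by have := inA _ _ s01 i0; rewrite scale0r addr0 scalerA.
  have Ayw : A (y + h *: w) by have := inA _ _ s01 i1; rewrite scale1r scalerA.
  have dy := Ck_derivable _ _ _ _ v fC2 Ay.
  have dyw := Ck_derivable _ _ _ _ v fC2 Ayw.
  have dshift : is_derive y v (fun z => f (z + h *: w)) ('D_v f (y + h *: w)).
    by apply: is_derive_line (derivableP dyw) => r /=; rewrite -addrA.
  exact: (is_deriveB dshift (derivableP dy)).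
have [s s01] : exists2 s : R, s \in `[0, 1] &
    g (x + h *: v) - g x = h * 'D_v g (x + (s * h) *: v).
  by apply: MVT_direction => s /dg [].
rewrite (@derive_val _ _ _ _ _ _ _ (dg s s01)).
have [t t01 ->] : exists2 t : R, t \in `[0, 1] &
    'D_v f (x + (s * h) *: v + h *: w) - 'D_v f (x + (s * h) *: v) =
    h * 'D_w ('D_v f) (x + (s * h) *: v + (t * h) *: w).
  apply: (MVT_direction ('D_v f) (x + (s * h) *: v) w h) => t t01.
  have := inA _ _ s01 t01; rewrite !scalerA.
  exact: (Ck_derivable _ _ _ _ w (Ck_derive _ _ _ v fC2)).
move=> E; exists s, t; split; [exact: s01|exact: t01|].
by rewrite !scalerA; exact: E.
Qed.

Lemma small_parallelogram {A x} v w : nbhs x A ->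
  exists2 h : R, h != 0 & forall s t : R, s \in `[0, 1] -> t \in `[0, 1] ->
    A (x + s *: (h *: v) + t *: (h *: w)).
Proof.
move=> /nbhs_ballP[d /= d0 dA].
(* The summand 1 keeps the denominator positive when [v] and [w] both vanish. *)
have den0 : 0 < `|v| + `|w| + 1.
  by apply: ltr_wpDl; [apply: addr_ge0; exact: normr_ge0|exact: ltr01].
have h0 : 0 < d / (`|v| + `|w| + 1) by exact: divr_gt0.
exists (d / (`|v| + `|w| + 1)); first exact: lt0r_neq0.
move=> s t s01 t01; apply/dA/ball_segments => //.
rewrite (normrZ _ v) (normrZ _ w) -mulrDr gtr0_norm //.
by rewrite mulrAC ltr_pdivrMr // ltr_pM2l // ltrDl.
Qed.

(** [F] and [G] share a value on every small parallelogram at [x], possibly at different points of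
    it; continuity puts that value within [e / 2] of both [F x] and [G x]. *)
Lemma eq_of_parallelograms {F G : V -> R} {A x} v w :
  {for x, continuous F} -> {for x, continuous G} -> nbhs x A ->
  (forall h : R, h != 0 ->
    (forall s t : R, s \in `[0, 1] -> t \in `[0, 1] ->
       A (x + s *: (h *: v) + t *: (h *: w))) ->
    exists s t s' t' : R, [/\ [/\ s \in `[0, 1], t \in `[0, 1], s' \in `[0, 1] &
      t' \in `[0, 1]] & F (x + s *: (h *: v) + t *: (h *: w)) =
                       G (x + s' *: (h *: v) + t' *: (h *: w))]) ->
  F x = G x.
Proof.
move=> cF cG nA FG; apply/eqP; rewrite -subr_eq0 -normr_le0.
apply/ler_addgt0Pr => e e0; rewrite add0r.
have e2 : 0 < e / 2 by rewrite divr_gt0.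
have close (H : V -> R) : {for x, continuous H} -> nbhs x [set z | `|H x - H z| < e / 2].
  by move=> /cvgrPdist_lt; apply.
have [h h0 small] := small_parallelogram v w
  (filterI nA (filterI (close F cF) (close G cG))).
have [|s [t [s' [t' [[s01 t01 s'01 t'01] FGz]]]]] := FG h h0.
  by move=> s t s01 t01; have [] := small s t s01 t01.
have [_ [Fz _]] := small s t s01 t01.
have [_ [_ Gz]] := small s' t' s'01 t'01.
rewrite -(subrKA (F (x + s *: (h *: v) + t *: (h *: w)))) [leRHS]splitr.
apply: le_trans (ler_normD _ _) _; apply: lerD; first exact: ltW.
by rewrite FGz distrC; exact: ltW.
Qed.

(** Schwarz's theorem: the second difference over a parallelogram is symmetric in [v] and [w], and
    is [h * h] times either mixed derivative at some point of it. *)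
Lemma derive_comm {A f x} v w : open A -> Ck_on 2 A f -> A x ->
  'D_w ('D_v f) x = 'D_v ('D_w f) x.
Proof.
move=> oA fC2 Ax.
have cont v' w' : {for x, continuous ('D_w' ('D_v' f))}.
  apply: Ck_continuous Ax; apply: Ck_derive; exact: Ck_derive fC2.
apply: (eq_of_parallelograms v w (cont v w) (cont w v)
  (open_nbhs_nbhs (conj oA Ax))) => h h0 inA.
have inA' (s t : R) : s \in `[0, 1] -> t \in `[0, 1] ->
    A (x + s *: (h *: w) + t *: (h *: v)).
  by move=> s01 t01; rewrite addrAC; exact: inA.
have [s [t [s01 t01 E]]] := second_difference fC2 inA.
have [s' [t' [s'01 t'01 E']]] := second_difference fC2 inA'.
exists s, t, t', s'; split; first by split.
rewrite [x + t' *: _ + _]addrAC.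
apply: (mulfI h0); apply: (mulfI h0).
apply: etrans (esym E) _; apply: etrans E'.
have subACA (a b c e : R) : a - b - (c - e) = a - c - (b - e) by ring.
by rewrite subACA [x + h *: w + _]addrAC.
Qed.

End Calculus.

(** * Closure properties of C^k functions *)

Section CkAlgebra.
Context {R : realType} {V : normedModType R}.
Implicit Types (A : set V) (x v : V).

Lemma near_eq_continuous {W : normedModType R} (f g : V -> W) x :
  {near x, f =1 g} -> {for x, continuous f} -> {for x, continuous g}.
Proof.
move=> fg cf; suff: g @ x --> g x by [].
rewrite -(nbhs_singleton fg); apply: cvg_trans cf.
exact: near_eq_cvg.
Qed.

(** Agreement on [A] is enough because [A] is open: derivatives at its points see only values taken
    in it. *)
Lemma Ck_ext {W : normedModType R} k A (f g : V -> W) : open A ->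
  (forall x, A x -> f x = g x) -> Ck_on k A f -> Ck_on k A g.
Proof.
move=> oA; elim: k f g => [|k IHk] f g fg [cf df].
all: have nfg x : A x -> {near x, f =1 g} by
  move=> Ax; apply: filterS (open_nbhs_nbhs (conj oA Ax)).
all: split; first by move=> x Ax; apply: near_eq_continuous (nfg x Ax) (cf x Ax).
  by [].
move=> v; have [dfv Dfv] := df v; split.
  by move=> x Ax; apply: near_eq_derivable (nfg x Ax) (dfv x Ax).
by apply: IHk Dfv => x Ax; apply: near_eq_derive; exact: nfg.
Qed.

Lemma Ck_le {W : normedModType R} k A (f : V -> W) : Ck_on k.+1 A f -> Ck_on k A f.
Proof.
elim: k f => [|k IHk] f [cf df]; split=> // v.
by have [dfv Dfv] := df v; split=> //; exact: IHk.
Qed.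

Implicit Types f g : V -> R.

Lemma Ck_cst k A (a : R) : Ck_on k A (fun=> a).
Proof.
elim: k a => [|k IHk] a; split; try by move=> x _; exact: cst_continuous.
  by [].
move=> v; split; first by move=> x _; exact: derivable_cst.
have -> : 'D_v (fun _ : V => a) = fun=> 0 by apply/funext => x; exact: derive_cst.
exact: IHk.
Qed.

Lemma Ck_D k A f g : open A -> Ck_on k A f -> Ck_on k A g ->
  Ck_on k A (fun x => f x + g x).
Proof.
move=> oA; elim: k f g => [|k IHk] f g [cf df] [cg dg]; split=> //.
- by move=> x Ax; apply: continuousD; [exact: cf|exact: cg].
- by move=> x Ax; apply: continuousD; [exact: cf|exact: cg].
move=> v; have [dfv Dfv] := df v; have [dgv Dgv] := dg v; split.
  by move=> x Ax; apply: derivableD; [exact: dfv|exact: dgv].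
apply: Ck_ext (IHk _ _ Dfv Dgv) => // x Ax.
by rewrite (deriveD (dfv x Ax) (dgv x Ax)).
Qed.

Lemma Ck_M k A f g : open A -> Ck_on k A f -> Ck_on k A g ->
  Ck_on k A (fun x => f x * g x).
Proof.
move=> oA; elim: k f g => [|k IHk] f g fk gk.
all: have cM : forall x, A x -> {for x, continuous (fun x => f x * g x)} by
  move=> x Ax; apply: continuousM; [exact: Ck_continuous fk Ax|exact: Ck_continuous gk Ax].
  by split.
split=> // v; split.
  by move=> x Ax; apply: derivableM;
    [exact: Ck_derivable fk Ax|exact: Ck_derivable gk Ax].
have := Ck_D _ _ _ _ oA (IHk _ _ (Ck_le _ _ _ fk) (Ck_derive _ _ _ v gk))
  (IHk _ _ (Ck_le _ _ _ gk) (Ck_derive _ _ _ v fk)).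
apply: Ck_ext => // x Ax.
by rewrite (deriveM (Ck_derivable _ _ _ _ v fk Ax) (Ck_derivable _ _ _ _ v gk Ax)).
Qed.

Lemma Ck_V k A f : open A -> (forall x, A x -> f x != 0) -> Ck_on k A f ->
  Ck_on k A (fun x => (f x)^-1).
Proof.
move=> oA f0; elim: k f f0 => [|k IHk] f f0 fk.
all: have cV : forall x, A x -> {for x, continuous (fun x => (f x)^-1)} by
  move=> x Ax; apply: continuousV; [exact: f0|exact: Ck_continuous fk Ax].
  by split.
split=> // v; split.
  by move=> x Ax; apply: derivableV; [exact: f0|exact: Ck_derivable fk Ax].
have fVk := IHk _ f0 (Ck_le _ _ _ fk).
have := Ck_M _ _ _ _ oA (Ck_cst k A (-1)) (Ck_M _ _ _ _ oA
  (Ck_M _ _ _ _ oA fVk fVk) (Ck_derive _ _ _ v fk)).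
apply: Ck_ext => // x Ax.
rewrite (deriveV (f0 x Ax) (Ck_derivable _ _ _ _ v fk Ax)).
by rewrite mulN1r -mulNr -invfM -expr2.
Qed.

Lemma Ck_sum k A I (r : seq I) (P : pred I) (F : I -> V -> R) : open A ->
  (forall i, Ck_on k A (F i)) -> Ck_on k A (fun x => \sum_(i <- r | P i) F i x).
Proof.
move=> oA Fk; elim: r => [|i r IHr].
  by apply: Ck_ext (Ck_cst k A 0) => // x _; rewrite big_nil.
case Pi: (P i); last first.
  by apply: Ck_ext IHr => // x _; rewrite big_cons Pi.
by apply: Ck_ext (Ck_D _ _ _ _ oA (Fk i) IHr) => // x _; rewrite big_cons Pi.
Qed.

Lemma Ck_prod k A I (r : seq I) (F : I -> V -> R) : open A ->
  (forall i, Ck_on k A (F i)) -> Ck_on k A (fun x => \prod_(i <- r) F i x).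
Proof.
move=> oA Fk; elim: r => [|i r IHr].
  by apply: Ck_ext (Ck_cst k A 1) => // x _; rewrite big_nil.
by apply: Ck_ext (Ck_M _ _ _ _ oA (Fk i) IHr) => // x _; rewrite big_cons.
Qed.

Lemma Ck_det k A m (F : V -> 'M[R]_m) : open A ->
  (forall i j, Ck_on k A (fun x => F x i j)) -> Ck_on k A (fun x => \det (F x)).
Proof.
move=> oA Fk; rewrite /determinant; apply: Ck_sum => // s.
by apply: Ck_M => //; [exact: Ck_cst|apply: Ck_prod].
Qed.

(** Cramer's rule: on [A] the inverse is the adjugate divided by the determinant, and both are
    polynomial in the entries. *)
Lemma Ck_invmx k A m (F : V -> 'M[R]_m) i j : open A ->
  (forall i j, Ck_on k A (fun x => F x i j)) ->
  (forall x, A x -> F x \in unitmx) -> Ck_on k A (fun x => invmx (F x) i j).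
Proof.
move=> oA Fk Fu.
have detk : Ck_on k A (fun x => (\det (F x))^-1).
  apply: Ck_V => //; last exact: Ck_det.
  by move=> x /Fu; rewrite unitmxE unitfE.
have adjk : Ck_on k A (fun x => \adj (F x) i j).
  apply: (@Ck_ext _ k A (fun x => (-1) ^+ (j + i) * \det (row' j (col' i (F x))))) => //.
    by move=> x _; rewrite mxE.
  apply: Ck_M => //; first exact: Ck_cst.
  apply: Ck_det => // i' j'.
  by apply: Ck_ext (Fk (lift j i') (lift i j')) => // x _; rewrite !mxE.
apply: Ck_ext (Ck_M _ _ _ _ oA detk adjk) => // x Ax.
by rewrite /invmx (Fu x Ax) !mxE.
Qed.

Lemma Ck_linear k A (f : V -> R) : linear f -> continuous f -> Ck_on k A f.
Proof.
move=> linf cf.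
have df x v : is_derive x v f (f v).
  pose F : {linear V -> R} := HB.pack f (GRing.isLinear.Build _ _ _ _ f linf).
  have dF : differentiable F x by apply: linear_differentiable.
  apply: DeriveDef; first exact: diff_derivable.
  rewrite deriveE //.
  have DF : ('d F x : V -> R) = F by exact: diff_lin.
  exact: (congr1 (fun h : V -> R => h v) DF).
have cfA x : A x -> {for x, continuous f} by move=> _; exact: cf.
case: k => [|k]; split=> // v; split; first by move=> x _; have [] := df x v.
have -> : 'D_v f = fun=> f v by apply/funext => x; have [] := df x v.
exact: Ck_cst.
Qed.

End CkAlgebra.

(** * Continuous partial derivatives imply Fréchet differentiability *)

Section C1Differentiable.
Context {R : realType} {V : normedModType R}.
Implicit Types (A : set V) (x v : V).

(* The increment is split into successive increments along the basis vectors;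
   each is controlled by the mean value theorem. *)
Lemma increment_littleo {I : Type} (e : I -> V) (p : I -> V -> R) {A x} {f : V -> R}
    (r : seq I) (eps : R) :
  (forall i h, `|p i h| <= `|h|) -> open A -> A x -> Ck_on 1 A f -> 0 < eps ->
  \forall h \near (0 : V),
    `|f (x + \sum_(i <- r) p i h *: e i) - f x -
      \sum_(i <- r) p i h * 'D_(e i) f x| <= eps * `|h|.
Proof.
move=> pb oA Ax f1; elim: r eps => [|i r IHr] eps eps0.
  near=> h; rewrite !big_nil addr0 !subrr normr0.
  by apply: mulr_ge0 (ltW eps0) (normr_ge0 h).
have i1 : (1 : R) \in `[0, 1] by rewrite in_itv /= lexx ler01.
have e20 : 0 < eps / 2 by rewrite divr_gt0.
have cD : {for x, continuous ('D_(e i) f)}.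
  exact: Ck_continuous (Ck_derive _ _ _ (e i) f1) Ax.
have /nbhs_ballP[d /= d0 dP] : nbhs x
    (A `&` [set z | `|'D_(e i) f x - 'D_(e i) f z| < eps / 2]).
  apply: filterI; first exact: open_nbhs_nbhs.
  by have /cvgrPdist_lt := cD; apply.
have sum0 : 0 <= \sum_(j <- r) `|e j| by apply: sumr_ge0.
have den0 : 0 < \sum_(j <- r) `|e j| + `|e i| + 1.
  by apply: ltr_wpDl; [apply: addr_ge0 => //; exact: normr_ge0|exact: ltr01].
near=> h.
(* This bound keeps the last leg of the path, starting after the increments along [r], inside the
   ball where ['D_(e i) f] varies by less than [eps / 2]. *)
have hd : `|h| < d / (\sum_(j <- r) `|e j| + `|e i| + 1).
  by near: h; apply: nbhs0_lt; exact: divr_gt0.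
have IHh : `|f (x + \sum_(j <- r) p j h *: e j) - f x -
    \sum_(j <- r) p j h * 'D_(e j) f x| <= eps / 2 * `|h|.
  by near: h; apply: IHr.
set S := \sum_(j <- r) p j h *: e j in IHh.
have hS : `|S| + `|p i h *: e i| < d.
  apply: (@le_lt_trans _ _ (`|h| * (\sum_(j <- r) `|e j| + `|e i|))).
    rewrite mulrDr lerD //; last by rewrite normrZ; apply: ler_wpM2r.
    apply: le_trans (ler_norm_sum _ _ _) _; rewrite mulr_sumr.
    by apply: ler_sum => j _; rewrite normrZ; apply: ler_wpM2r.
  rewrite ltr_pdivlMr // in hd; apply: le_lt_trans hd.
  by rewrite ler_wpM2l // lerDl.
have near_seg (s : R) : s \in `[0, 1] -> ball x d (x + S + (s * p i h) *: e i).
  by move=> s01; have := ball_segments i1 s01 hS; rewrite scale1r scalerA; apply.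
have [s s01 E] : exists2 s : R, s \in `[0, 1] &
    f (x + S + p i h *: e i) - f (x + S) =
    p i h * 'D_(e i) f (x + S + (s * p i h) *: e i).
  apply: (MVT_direction f (x + S) (e i) (p i h)) => s /near_seg/dP[Az _].
  exact: Ck_derivable f1 Az.
have [_ /= close] := dP _ (near_seg s s01).
rewrite !big_cons -/S [_ *: _ + S]addrC addrA.
move/eqP: E; rewrite subr_eq => /eqP ->.
have regroup (a b c u w t : R) : a * b + c - u - (a * w + t) =
    c - u - t - a * (w - b) by ring.
rewrite regroup [eps]splitr mulrDl; apply: le_trans (ler_normB _ _) _.
rewrite lerD // normrM mulrC; apply: ler_pM => //; exact: ltW.
Unshelve. all: by end_near. Qed.

(** The basis [e] and the coordinates [p] stay abstract so that one proof serves both row vectors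
    and pairs (x, y). The candidate differential combines the partial derivatives, and
    [increment_littleo] is its defining estimate. *)
Lemma C1_differentiable {I : finType} (e : I -> V) (p : I -> V -> R) {A x}
    {f : V -> R} :
  (forall i, linear (p i)) -> (forall i h, `|p i h| <= `|h|) ->
  (forall h, h = \sum_i p i h *: e i) ->
  open A -> A x -> Ck_on 1 A f -> differentiable f x.
Proof.
move=> lp pb pe oA Ax f1.
pose df (h : V) := \sum_i p i h * 'D_(e i) f x.
have ldf : linear df.
  move=> a h k; rewrite /df scaler_sumr -big_split /=.
  by apply: eq_bigr => i _; rewrite lp mulrDl scalerAl.
pose L : {linear V -> R} := HB.pack df (GRing.isLinear.Build _ _ _ _ df ldf).
have cL : continuous L.
  apply/bounded_linear_continuous/linear_boundedP.
  exists (\sum_i `|'D_(e i) f x|); split; first exact: num_real.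
  move=> r /ltW ler h; apply: le_trans (ler_norm_sum _ _ _) _.
  apply: (@le_trans _ _ (\sum_i `|'D_(e i) f x| * `|h|)).
    by apply: ler_sum => i _; rewrite normrM mulrC ler_wpM2l.
  by rewrite -mulr_suml ler_wpM2r.
have fL : f \o shift x = cst (f x) + L +o_ 0 id.
  apply/eqaddoP => eps eps0.
  apply: filterS (increment_littleo e p (index_enum I) eps pb oA Ax f1 eps0) => h.
  by rewrite -pe [x + h]addrC -addrA -opprD.
apply/diff_locallyP; rewrite (diff_unique cL fL); split=> //.
Qed.
End C1Differentiable.

(** * Differentiability on row vectors and on pairs (x, y) *)

Section FiniteDimension.
Context {R : realType} {n : nat}.

Lemma coord_norm_le (h : 'rV[R]_n) i : `|h 0 i| <= `|h|.
Proof.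
rewrite [leRHS]/Num.Def.normr/= mx_normrE.
exact: (le_bigmax _ _ (0, i)).
Qed.

Lemma C1_differentiable_rV {A : set 'rV[R]_n} {x} {f : 'rV[R]_n -> R} :
  open A -> A x -> Ck_on 1 A f -> differentiable f x.
Proof.
apply: (C1_differentiable (fun i => delta_mx 0 i) (fun i h => h 0 i)).
- by move=> i a h k; rewrite !mxE.
- by move=> i h; exact: coord_norm_le.
- by move=> h; exact: row_sum_delta.
Qed.

Lemma C1_differentiable_TM {A : set (TMpt R n)} {u} {f : TMpt R n -> R} :
  open A -> A u -> Ck_on 1 A f -> differentiable f u.
Proof.
pose e (i : 'I_n + 'I_n) : TMpt R n :=
  match i with inl a => (delta_mx 0 a, 0) | inr a => (0, delta_mx 0 a) end.
pose p (i : 'I_n + 'I_n) (h : TMpt R n) : R :=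
  match i with inl a => h.1 0 a | inr a => h.2 0 a end.
apply: (C1_differentiable e p).
- by case=> i a h k; rewrite /p /= !mxE.
- case=> i h; rewrite /p; apply: le_trans (coord_norm_le _ _) _.
    by rewrite prod_normE /= le_max lexx.
  by rewrite prod_normE /= le_max lexx orbT.
- move=> h; rewrite big_sumType /= /p /e.
  have E1 : \sum_i h.1 0 i *: ((delta_mx 0 i, 0) : TMpt R n) = (h.1, 0).
    rewrite [X in (X, 0)]row_sum_delta.
    elim/big_rec2: _ => // i y1 y2 _ ->.
    by congr (_, _) => /=; rewrite scaler0 addr0.
  have E2 : \sum_i h.2 0 i *: ((0, delta_mx 0 i) : TMpt R n) = (0, h.2).
    rewrite [X in (0, X)]row_sum_delta.
    elim/big_rec2: _ => // i y1 y2 _ ->.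
    by congr (_, _) => /=; rewrite scaler0 addr0.
  rewrite E1 E2; case: h {E1 E2} => h k.
  by congr (_, _) => /=; rewrite ?addr0 ?add0r.
Qed.

(** Additivity in the direction comes from the Fréchet differential; directional derivatives by
    themselves are only homogeneous in it. *)
Lemma derive_vertical {A : set (TMpt R n)} {u} {f : TMpt R n -> R} (v : 'rV[R]_n) :
  open A -> A u -> Ck_on 1 A f -> 'D_(0, v) f u = \sum_a v 0 a * dy a f u.
Proof.
move=> oA Au f1; have df := C1_differentiable_TM oA Au f1.
have -> : (0, v) = \sum_a v 0 a *: ((0, delta_mx 0 a) : TMpt R n).
  rewrite [v in (0, v)]row_sum_delta.
  elim/big_rec2: _ => // i y1 y2 _ <-.
  by congr (_, _) => /=; rewrite scaler0 addr0.
rewrite deriveE // linear_sum; apply: eq_bigr => a _.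
by rewrite linearZ /dy deriveE.
Qed.

Lemma C1_differentiable_map {m} {A : set 'rV[R]_n} {x} {f : 'rV[R]_n -> 'rV[R]_m} :
  open A -> A x -> Ck_on 1 A f -> differentiable f x.
Proof.
move=> oA Ax f1.
have fj1 j : Ck_on 1 A (fun x => f x 0 j).
  have coordc : continuous (fun y : 'rV[R]_m => y 0 j) by exact: coord_continuous.
  split=> [y Ay|v].
    apply: (@continuous_comp _ _ _ f (fun y : 'rV[R]_m => y 0 j)).
      exact: Ck_continuous f1 Ay.
    exact: coordc.
  have dfv y (Ay : A y) := Ck_derivable _ _ _ _ v f1 Ay; split=> [y Ay|].
    by have /derivable_mxP := dfv y Ay; apply.
  split=> // y Ay.
  (* Taking a coordinate commutes with ['D_v] where [f] is derivable, hence on [A], which contains a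
     neighbourhood of [y]. *)
  apply: (near_eq_continuous (fun z => 'D_v f z 0 j)).
    apply: filterS (open_nbhs_nbhs (conj oA Ay)) => z Az.
    by rewrite (derive_mx (dfv z Az)) mxE.
  apply: (@continuous_comp _ _ _ ('D_v f) (fun y : 'rV[R]_m => y 0 j)).
    exact: Ck_continuous (Ck_derive _ _ _ v f1) Ay.
  exact: coordc.
have -> : f = \sum_(j < m) (fun x => f x 0 j *: (delta_mx 0 j : 'rV[R]_m)).
  apply/funext => y; rewrite fct_sumE; exact: row_sum_delta.
apply: differentiable_sum => j; apply: differentiableZl.
exact: C1_differentiable_rV oA Ax (fj1 j).
Qed.

End FiniteDimension.

(** By the chain rule the differential of [g] sends ['D_y f x] back to [y]. *)
Lemma derive_inj_of_left_inverse {R : realType} {V W : normedModType R}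
    {f : V -> W} {g : W -> V} {x y : V} :
  differentiable f x -> differentiable g (f x) -> {near x, id =1 g \o f} ->
  'D_y f x = 0 -> y = 0.
Proof.
move=> df dg gf; rewrite deriveE // => fy0.
have <- : 'D_y (g \o f) x = y by rewrite -(near_eq_derive y gf) derive_id.
rewrite deriveE; last exact: differentiable_comp.
by rewrite diff_comp //= fy0 linear0.
Qed.

(** * Chart domains and changes of charts *)

Section ChartDomains.
Context {R : realType} {n : nat} {M : smoothManifold R n}.
Implicit Types c d : chart_index M.

Lemma TMdom_open slit c : open (TMdom slit c).
Proof.
rewrite openE => u [cu yu]; apply: filterI.
  have /(_ u) : continuous (fst : TMpt R n -> 'rV[R]_n) by move=> ?; exact: cvg_fst.
  by apply; apply: open_nbhs_nbhs; split => //; exact: chart_img_open.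
case: slit yu => [/(_ isT)/eqP yu|_]; last by apply: filterE.
apply: filterS (cvgr_neq0 _ (@cvg_snd _ _ _ _ _) yu) => v /eqP v0 _.
exact: v0.
Qed.

Lemma overlap_open c d : open (overlap (atlas c) (atlas d)).
Proof.
rewrite openE => _ [p [cp dp] <-].
have cx : (chart_fun (atlas c) @` chart_dom (atlas c)) (chart_fun (atlas c) p).
  by exists p.
have near_d : \forall x \near chart_fun (atlas c) p,
    chart_dom (atlas d) (chart_inv (atlas c) x).
  apply: (chart_inv_continuous cx); rewrite chart_funK //.
  by apply: open_nbhs_nbhs; split => //; exact: chart_dom_open.
have near_c := open_nbhs_nbhs (conj (@chart_img_open _ _ _ (atlas c)) cx).
apply: filterS (filterI near_c near_d) => _ [[q cq <-]] dq.
by exists q => //; split=> //; move: dq; rewrite chart_funK.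
Qed.

(** [y *m jac c d x] is the derivative of the transition map along [y], and the opposite transition
    is a left inverse near [x]. *)
Lemma jac_injective c d (x y : 'rV[R]_n) : overlap (atlas c) (atlas d) x ->
  y *m jac c d x = 0 -> y = 0.
Proof.
move=> cdx yJ.
have [p [cp dp] px] := cdx.
have dcx : overlap (atlas d) (atlas c) (transition (atlas c) (atlas d) x).
  by exists p => //; rewrite /transition /= -px chart_funK.
have df := C1_differentiable_map (overlap_open c d) cdx (atlas_smooth c d 1).
have dg := C1_differentiable_map (overlap_open d c) dcx (atlas_smooth d c 1).
have gf : {near x, id =1
    transition (atlas d) (atlas c) \o transition (atlas c) (atlas d)}.
  apply: filterS (open_nbhs_nbhs (conj (overlap_open c d) cdx)).
  by move=> _ [q [cq dq] <-]; rewrite /transition /= !chart_funK.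
apply: (derive_inj_of_left_inverse df dg gf).
by rewrite (deriveEjacobian y df); exact: yJ.
Qed.

Lemma TMtransition_dom slit c d u : TMoverlap slit c d u ->
  TMdom slit d (TMtransition c d u).
Proof.
move=> [[cu yu] cdu]; split=> [|s]; last first.
  (* On the slit bundle a nonzero fibre vector has to remain nonzero. *)
  by move=> /= yJ; apply: (yu s); exact: jac_injective cdu yJ.
case: cdu => p [cp dp] pu; rewrite /= -pu /transition /= chart_funK //.
by exists p.
Qed.
End ChartDomains.

(** * Derivatives in the coordinates (x, y) *)

Section CoordinateDerivatives.
Context {R : realType} {n : nat}.
Implicit Types (f : TMpt R n -> R) (u : TMpt R n).

Lemma derive_sum_mul {V : normedModType R} {m} {F G : 'I_m -> V -> R} {u v : V} :
  (forall i, derivable (F i) u v) -> (forall i, derivable (G i) u v) ->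
  'D_v (fun z => \sum_i F i z * G i z) u =
  \sum_i ('D_v (F i) u * G i u + F i u * 'D_v (G i) u).
Proof.
move=> dF dG.
have -> : (fun z => \sum_i F i z * G i z) = \sum_i (fun z => F i z * G i z).
  by apply/funext => z; rewrite fct_sumE.
rewrite derive_sum => [|i]; last exact: derivableM.
apply: eq_bigr => i _; rewrite [LHS](deriveM (dF i) (dG i)) addrC.
by congr (_ + _); exact: mulrC.
Qed.

Lemma dadapted_sum_mul {m} {F G : 'I_m -> TMpt R n -> R}
    (N : 'I_n -> 'I_n -> TMpt R n -> R) mu u :
  (forall i v, derivable (F i) u v) -> (forall i v, derivable (G i) u v) ->
  dadapted N mu (fun z => \sum_i F i z * G i z) u =
  \sum_i (dadapted N mu (F i) u * G i u + F i u * dadapted N mu (G i) u).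
Proof.
move=> dF dG; rewrite /dadapted /dx /dy derive_sum_mul //.
under [X in _ - X]eq_bigr do rewrite derive_sum_mul // mulr_sumr.
rewrite exchange_big -sumrB; apply: eq_bigr => i _ /=.
rewrite mulrBl mulrBr mulr_suml mulr_sumr addrACA -opprD -big_split /=.
by congr (_ - _); apply: eq_bigr => a _; ring.
Qed.

Lemma yfield_Ck k (A : set (TMpt R n)) b : Ck_on k A (yfield b).
Proof.
apply: Ck_linear => [a u v|u]; first by rewrite /yfield /= !mxE.
apply: (@continuous_comp _ _ _ snd (fun y : 'rV[R]_n => y 0 b)).
  exact: cvg_snd.
exact: coord_continuous.
Qed.

Lemma derive_yfield b u (v : TMpt R n) : 'D_v (yfield b) u = v.2 0 b.
Proof.
suff : is_derive u v (yfield b) (v.2 0 b) by case.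
apply: (@is_derive_line _ _ _ (fun h : R => yfield b u + h * v.2 0 b) _ 0 1).
  by move=> h; rewrite /yfield /= !mxE addr0 [h *: 1]mulr1 addrC.
have -> : (fun h : R => yfield b u + h * v.2 0 b) =
    cst (yfield b u) + (v.2 0 b \*: id).
  by apply/funext => h /=; rewrite mulrC.
apply: is_derive_eq; rewrite add0r; exact: mulr1.
Qed.

Lemma dy_yfield a c u : dy c (yfield a) u = (a == c)%:R.
Proof. by rewrite /dy derive_yfield /= mxE eqxx. Qed.

Lemma dx_yfield a mu u : dx mu (yfield a) u = 0.
Proof. by rewrite /dx derive_yfield /= mxE. Qed.

Lemma sum_delta (F : 'I_n -> R) a : \sum_b (a == b)%:R * F b = F a.
Proof.
rewrite (bigD1 a) //= eqxx mul1r big1 ?addr0 // => b.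
by rewrite eq_sym => /negPf ->; rewrite mul0r.
Qed.

(** The dilation (x, y) to (x, t y) carries the direction (v, w) to (v, t w). Hence a derivative
    along x keeps the degree of homogeneity, and one along y lowers it by one. *)
Lemma derive_pos_homogeneous {A : set (TMpt R n)} {k f} {x y v w : 'rV[R]_n} {t : R} :
  open A -> Ck_on 1 A f -> pos_homogeneous A k f -> A (x, y) -> A (x, t *: y) ->
  0 < t -> 'D_(v, t *: w) f (x, t *: y) = t ^+ k * 'D_(v, w) f (x, y).
Proof.
move=> oA f1 homf Axy Axty t0.
have dt : is_derive ((x, y) : TMpt R n) ((v, w) : TMpt R n)
    (fun z : TMpt R n => f (z.1, t *: z.2)) ('D_(v, t *: w) f (x, t *: y)).
  apply: is_derive_line (derivableP (Ck_derivable _ _ _ _ (v, t *: w) f1 Axty)) => h.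
  by congr f; congr (_, _) => /=; rewrite scalerDr !scalerA mulrC.
rewrite -(@derive_val _ _ _ _ _ _ _ dt).
have df := Ck_derivable _ _ _ _ (v, w) f1 Axy.
rewrite -[RHS](deriveZ (t ^+ k) df).
apply: near_eq_derive; apply: filterS (open_nbhs_nbhs (conj oA Axy)) => -[x' y'] Az.
exact: homf.
Qed.

End CoordinateDerivatives.

(** * Frame, coframe, metric and canonical connection in one chart *)

Section LocalGeometry.
Context {R : realType} {n : nat} {A : set (TMpt R n)}.
Context {N lh lam : 'I_n -> 'I_n -> TMpt R n -> R}.
Context (oA : open A).
Context (cone : forall x y (t : R), A (x, y) -> 0 < t -> A (x, t *: y)).
Context (N_Ck : forall k a mu, Ck_on k A (N a mu)).
Context (lam_Ck : forall k i a, Ck_on k A (lam i a)).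
Context (lam_unit : forall u, A u -> \matrix_(i < n, a < n) lam i a u \in unitmx).

Local Notation D := (canonicalD N lh lam).
Local Notation Dn := (naturalD N lh lam).
Local Notation th := (coframe lam).
Local Notation g := (metric lam).

Lemma coframe_Ck k i a : Ck_on k A (th i a).
Proof.
apply: (@Ck_invmx _ _ k A n (fun u => \matrix_(j < n, b < n) lam j b u)) => //.
by move=> j b; apply: Ck_ext (lam_Ck k j b) => // u _; rewrite mxE.
Qed.

Lemma lam_coframe u i j : A u -> \sum_a lam i a u * th j a u = (i == j)%:R.
Proof.
move=> /lam_unit /mulmxV /matrixP /(_ i j); rewrite !mxE => <-.
by apply: eq_bigr => a _; rewrite mxE.
Qed.

Lemma coframe_lam u a b : A u -> \sum_i th i a u * lam i b u = (a == b)%:R.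
Proof.
move=> /lam_unit /mulVmx /matrixP /(_ a b); rewrite !mxE => <-.
by apply: eq_bigr => i _; rewrite mxE.
Qed.

Lemma frame_components (X Y : 'I_n -> R) u : A u ->
  (forall i, \sum_a th i a u * X a = Y i) -> forall a, X a = \sum_i lam i a u * Y i.
Proof.
move=> Au XY a; under eq_bigr do rewrite -XY mulr_sumr.
rewrite exchange_big /=.
under eq_bigr => b _.
  under eq_bigr do rewrite mulrA.
  rewrite -mulr_suml.
  under eq_bigr do rewrite mulrC.
  rewrite coframe_lam // eq_sym.
  over.
by rewrite sum_delta.
Qed.

Lemma coframe_components (X Y : 'I_n -> R) u : A u ->
  (forall a, X a = \sum_i lam i a u * Y i) -> forall i, \sum_a th i a u * X a = Y i.
Proof.
move=> Au XY i; under eq_bigr do rewrite XY mulr_sumr.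
rewrite exchange_big /=.
under eq_bigr => j _.
  under eq_bigr do rewrite mulrA.
  rewrite -mulr_suml.
  under eq_bigr do rewrite mulrC.
  rewrite lam_coframe // eq_sym.
  over.
by rewrite sum_delta.
Qed.

(** Identities in an upper index are tested on the coframe: it cancels the factor lambda_i^a in the
    canonical coefficients and leaves derivatives of lambda_{ib}. *)
Lemma coframe_inj (X Y : 'I_n -> R) u : A u ->
  (forall i, \sum_a th i a u * X a = \sum_a th i a u * Y a) -> forall a, X a = Y a.
Proof.
move=> Au XY a; rewrite (frame_components X _ u Au XY a).
by rewrite -(frame_components Y _ u Au (fun=> erefl) a).
Qed.

Lemma coframe_Gam u i b mu : A u ->
  \sum_a th i a u * Gam_v D a b mu u = dadapted N mu (th i b) u.
Proof.
by move=> Au; apply: (coframe_components (fun a => Gam_v D a b mu u)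
  (fun i => dadapted N mu (th i b) u) u Au).
Qed.

Lemma coframe_C u i b c : A u -> \sum_a th i a u * C_v D a b c u = dy c (th i b) u.
Proof.
by move=> Au; apply: (coframe_components (fun a => C_v D a b c u)
  (fun i => dy c (th i b) u) u Au).
Qed.

Lemma coframe_derivable i a u v : A u -> derivable (th i a) u v.
Proof. exact: Ck_derivable (coframe_Ck 1 i a). Qed.

Lemma dy_metric u a b c : A u ->
  dy c (g a b) u = \sum_i (dy c (th i a) u * th i b u + th i a u * dy c (th i b) u).
Proof. by move=> Au; apply: derive_sum_mul => i; exact: coframe_derivable. Qed.

Lemma dadapted_metric u a b mu : A u ->
  dadapted N mu (g a b) u = \sum_i (dadapted N mu (th i a) u * th i b u +
                                    th i a u * dadapted N mu (th i b) u).
Proof. by move=> Au; apply: dadapted_sum_mul => i v; exact: coframe_derivable. Qed.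

Lemma metric_unit u : A u -> \matrix_(a < n, b < n) g a b u \in unitmx.
Proof.
move=> Au; have -> : \matrix_(a < n, b < n) g a b u =
    invmx (\matrix_(i < n, a < n) lam i a u) *m
    (invmx (\matrix_(i < n, a < n) lam i a u))^T.
  by apply/matrixP => a b; rewrite !mxE; apply: eq_bigr => i _; rewrite mxE.
by rewrite unitmx_mul unitmx_tr unitmx_inv lam_unit.
Qed.

Lemma metric_sum u a (X : 'I_n -> R) :
  \sum_b g a b u * X b = \sum_i th i a u * \sum_b th i b u * X b.
Proof.
under [RHS]eq_bigr do rewrite mulr_sumr.
rewrite exchange_big /=; apply: eq_bigr => b _; rewrite /metric mulr_suml.
by apply: eq_bigr => i _; rewrite mulrA.
Qed.

Lemma imetric_metric u a (X : 'I_n -> R) : A u ->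
  \sum_d imetric lam a d u * (\sum_e g d e u * X e) = X a.
Proof.
move=> Au; under eq_bigr do rewrite mulr_sumr.
rewrite exchange_big /=.
under eq_bigr => e _.
  under eq_bigr do rewrite mulrA.
  rewrite -mulr_suml.
  over.
rewrite -[RHS](sum_delta X); apply: eq_bigr => e _; congr (_ * _).
have /mulVmx /matrixP /(_ a e) := metric_unit u Au; rewrite !mxE => <-.
by apply: eq_bigr => d _; rewrite mxE.
Qed.

Lemma metric_symmetric a b u : g a b u = g b a u.
Proof. by apply: eq_bigr => i _; exact: mulrC. Qed.

(** Contracted with lambda_{ja}, the covariant derivative becomes the derivative of lambda_i^a
    lambda_{ja}, which is constant on [A]. *)
Lemma lam_parallel u i a b : A u -> vcov D (lam i) a b u = 0.
Proof.
move=> Au.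
suff E j : \sum_d th j d u * vcov D (lam i) d b u = 0.
  rewrite (frame_components _ _ u Au E a); apply: big1 => j _; exact: mulr0.
rewrite /vcov.
under eq_bigr do rewrite mulrDr.
rewrite big_split /=.
have -> : \sum_d th j d u * (\sum_c lam i c u * C_v D d c b u) =
          \sum_c lam i c u * dy b (th j c) u.
  under eq_bigr do rewrite mulr_sumr.
  rewrite exchange_big /=; apply: eq_bigr => c _.
  rewrite -(coframe_C u j c b Au) mulr_sumr; apply: eq_bigr => d _; exact: mulrCA.
have dlam d : derivable (lam i d) u ((0, delta_mx 0 b) : TMpt R n).
  exact: Ck_derivable (lam_Ck 1 i d) Au.
rewrite -big_split /=.
rewrite (_ : \sum_d _ = dy b (fun z => \sum_d lam i d z * th j d z) u); last first.
  rewrite /dy derive_sum_mul => [|//|d]; last exact: coframe_derivable.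
  by apply: eq_bigr => d _; rewrite mulrC.
rewrite -[RHS](derive_cst ((i == j)%:R : R) u ((0, delta_mx 0 b) : TMpt R n)).
apply: near_eq_derive; apply: filterS (open_nbhs_nbhs (conj oA Au)) => z Az.
exact: lam_coframe.
Qed.

(** With its upper index lowered, C becomes lambda_{ia} times the derivative of lambda_{ib}, so the
    two correction terms are the two halves of the Leibniz rule for [g]. *)
Lemma metric_parallel u a b c : A u -> vcov2 D g a b c u = 0.
Proof.
move=> Au; rewrite /vcov2 dy_metric //.
have gC a' b' : \sum_d g a' d u * C_v D d b' c u = \sum_i th i a' u * dy c (th i b') u.
  by rewrite metric_sum; apply: eq_bigr => i _; rewrite coframe_C.
have -> : \sum_d g d b u * C_v D d a c u = \sum_d g b d u * C_v D d a c u.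
  by apply: eq_bigr => d _; rewrite metric_symmetric.
rewrite !gC -!sumrB; apply: big1 => i _; ring.
Qed.

(** * Consequences of the Cartan conditions *)

Context (cartan_h : forall u, A u -> forall a mu, hcov N D yfield a mu u = 0).
Context (cartan_v : forall u, A u -> forall a b,
  vcov D yfield a b u = (a == b)%:R).

(* A potential of the coframe in the vertical directions: its derivative along
   y^c is lambda_{ic}, and its derivative along x^mu is lambda_{ia} N^a_mu. *)
Local Notation f := (fun i u => \sum_b yfield b u * th i b u).

Lemma potential_Ck k i : Ck_on k A (f i).
Proof. by apply: Ck_sum => // b; apply: Ck_M => //; [exact: yfield_Ck|exact: coframe_Ck]. Qed.

Lemma yfield_derivable b u (v : TMpt R n) : derivable (yfield b) u v.
Proof. by apply: Ck_derivable (yfield_Ck 1 setT b) _. Qed.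

Lemma y_dy_coframe u i c : A u -> \sum_b yfield b u * dy c (th i b) u = 0.
Proof.
move=> Au.
have yC a : \sum_b yfield b u * C_v D a b c u = 0.
  have := cartan_v u Au a c; rewrite /vcov dy_yfield.
  by rewrite -[X in _ = X]addr0 => /addrI.
under eq_bigr do rewrite -coframe_C // mulr_sumr.
rewrite exchange_big; apply: big1 => a _.
under eq_bigr do rewrite mulrCA.
by rewrite -mulr_sumr yC mulr0.
Qed.

Lemma N_eq u a mu : A u -> N a mu u = \sum_b yfield b u * Gam_v D a b mu u.
Proof.
move=> Au; have := cartan_h u Au a mu.
rewrite /hcov /dadapted dx_yfield sub0r.
under eq_bigr do rewrite dy_yfield mulrC.
by rewrite sum_delta => /eqP; rewrite addrC subr_eq0 => /eqP.
Qed.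

(** The Cartan condition gives y^b delta_mu lambda_{ib}. The vertical part of delta_mu contributes
    N^d_mu times y^b (d lambda_{ib} / d y^d), which is zero; this is why the plain partial
    derivative appears in (a). *)
Lemma coframe_N u i mu : A u ->
  \sum_a th i a u * N a mu u = \sum_b yfield b u * dx mu (th i b) u.
Proof.
move=> Au; under eq_bigr do rewrite N_eq // mulr_sumr.
rewrite exchange_big.
under eq_bigr => b _.
  under eq_bigr do rewrite mulrCA.
  rewrite -mulr_sumr coframe_Gam // /dadapted mulrBr mulr_sumr.
  over.
rewrite sumrB [X in _ - X]exchange_big [X in _ - X]big1 ?subr0 // => d _.
under eq_bigr do rewrite mulrCA.
by rewrite -mulr_sumr y_dy_coframe // mulr0.
Qed.

Lemma N_formula u a mu : A u ->
  N a mu u = \sum_b yfield b u * \sum_i lam i a u * dx mu (th i b) u.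
Proof.
move=> Au; rewrite (frame_components (fun a => N a mu u) _ u Au
  (fun i => coframe_N u i mu Au) a).
under eq_bigr do rewrite mulr_sumr.
rewrite exchange_big; apply: eq_bigr => b _; rewrite mulr_sumr.
by apply: eq_bigr => i _; exact: mulrCA.
Qed.

Lemma dy_potential u i c : A u -> dy c (f i) u = th i c u.
Proof.
move=> Au; rewrite {1}/dy derive_sum_mul => [|b|b]; first last.
- exact: coframe_derivable.
- exact: yfield_derivable.
rewrite big_split /= [X in _ + X](y_dy_coframe u i c Au) addr0.
rewrite -[RHS](sum_delta (fun b => th i b u)); apply: eq_bigr => b _.
by rewrite -/(dy c (yfield b) u) dy_yfield eq_sym.
Qed.

Lemma dx_potential u i mu : A u -> dx mu (f i) u = \sum_a th i a u * N a mu u.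
Proof.
move=> Au; rewrite coframe_N // {1}/dx derive_sum_mul => [|b|b]; first last.
- exact: coframe_derivable.
- exact: yfield_derivable.
by apply: eq_bigr => b _; rewrite -/(dx mu (yfield b) u) dx_yfield mul0r add0r.
Qed.

Lemma derive_congr (F G : TMpt R n -> R) u v : A u -> (forall z, A z -> F z = G z) ->
  'D_v F u = 'D_v G u.
Proof.
move=> Au FG; apply: near_eq_derive.
exact: filterS (open_nbhs_nbhs (conj oA Au)).
Qed.

Lemma dy_coframe_symmetric u i b c : A u -> dy b (th i c) u = dy c (th i b) u.
Proof.
move=> Au; rewrite /dy.
rewrite -(derive_congr (dy c (f i)) _ u _ Au (fun z => dy_potential z i c)).
rewrite -(derive_congr (dy b (f i)) _ u _ Au (fun z => dy_potential z i b)).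
exact: derive_comm oA (potential_Ck 2 i) Au.
Qed.

(** This is the mixed derivative of the potential along x^mu and y^c, computed in both orders. *)
Lemma dx_coframe u i c mu : A u ->
  dx mu (th i c) u = \sum_a (dy c (th i a) u * N a mu u + th i a u * dy c (N a mu) u).
Proof.
move=> Au; rewrite {1}/dx.
rewrite -(derive_congr (dy c (f i)) _ u _ Au (fun z => dy_potential z i c)).
rewrite [LHS](derive_comm _ _ oA (potential_Ck 2 i) Au).
rewrite (derive_congr (dx mu (f i)) _ u _ Au (fun z => dx_potential z i mu)).
rewrite derive_sum_mul // => a; first exact: coframe_derivable.
exact: Ck_derivable (N_Ck 1 a mu) Au.
Qed.

(** By the symmetry of the vertical derivatives, the first term of [dx_coframe] is N^a_mu (d
    lambda_{ic} / d y^a), exactly what delta_mu subtracts from the partial derivative. *)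
Lemma coframe_dyN u i c mu : A u ->
  \sum_a th i a u * dy c (N a mu) u = dadapted N mu (th i c) u.
Proof.
move=> Au; rewrite /dadapted dx_coframe // big_split /= addrC.
rewrite -[LHS]addr0 -addrA; congr (_ + _); apply/esym/eqP.
rewrite subr_eq0; apply/eqP/eq_bigr => a _.
by rewrite mulrC dy_coframe_symmetric.
Qed.

Lemma dyN_Gam u a c mu : A u -> dy c (N a mu) u = Gam_v D a c mu u.
Proof.
move=> Au; apply: (coframe_inj (fun a => dy c (N a mu) u)
  (fun a => Gam_v D a c mu u) u Au) => i.
by rewrite coframe_dyN // coframe_Gam.
Qed.

Lemma C_symmetric u a b c : A u -> C_v D a b c u = C_v D a c b u.
Proof.
move=> Au; apply: (coframe_inj (fun a => C_v D a b c u)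
  (fun a => C_v D a c b u) u Au) => i.
by rewrite !coframe_C // dy_coframe_symmetric.
Qed.

Lemma coframe_dxN u i mu nu : A u -> \sum_a th i a u * dx nu (N a mu) u =
  dx nu (dx mu (f i)) u - \sum_a dx nu (th i a) u * N a mu u.
Proof.
move=> Au; rewrite {2}/dx.
rewrite (derive_congr (dx mu (f i)) _ u _ Au (fun z => dx_potential z i mu)).
rewrite derive_sum_mul => [|a|a].
- by rewrite big_split /= addrAC subrr add0r.
- exact: coframe_derivable.
- exact: Ck_derivable (N_Ck 1 a mu) Au.
Qed.

Lemma curvN0 u a mu nu : A u -> curvN N a mu nu u = 0.
Proof.
move=> Au.
suff S i : \sum_a th i a u * curvN N a mu nu u = 0.
  rewrite (frame_components (fun a => curvN N a mu nu u) _ u Au S a).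
  apply: big1 => i _; exact: mulr0.
(* The curvature antisymmetrizes delta_k N^a_m, so it suffices that the contraction with the coframe
   be symmetric in m and k. [P] is a second derivative of the potential, [Q] collects the vertical
   derivatives of the coframe, and [W] enters together with its transpose: one copy comes from
   [dx_coframe], the other from the vertical part of delta_k. *)
have [P [Q [W [Psym Qsym E]]]] : exists P Q W : 'I_n -> 'I_n -> R,
    [/\ forall m k, P m k = P k m, forall m k, Q m k = Q k m &
        forall m k, \sum_a th i a u * dadapted N k (N a m) u =
                    P m k - (Q m k + (W m k + W k m))].
  exists (fun m k => dx k (dx m (f i)) u).
  exists (fun m k => \sum_a \sum_b N a m u * N b k u * dy a (th i b) u).
  exists (fun m k => \sum_a \sum_b N a m u * (th i b u * dy a (N b k) u)).
  split=> m k.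
  - exact: derive_comm oA (potential_Ck 2 i) Au.
  - rewrite exchange_big; apply: eq_bigr => b _; apply: eq_bigr => a' _ /=.
    by rewrite dy_coframe_symmetric // [N a' _ _ * _]mulrC.
  - rewrite /dadapted.
    under eq_bigr do rewrite mulrBr.
    rewrite sumrB coframe_dxN // -addrA -opprD addrA.
    congr (_ - (_ + _)).
      rewrite -big_split; apply: eq_bigr => b _ /=.
      rewrite dx_coframe // mulr_suml -big_split; apply: eq_bigr => a' _ /=; ring.
    under eq_bigr do rewrite mulr_sumr.
    rewrite exchange_big; apply: eq_bigr => b _; apply: eq_bigr => a' _.
    exact: mulrCA.
rewrite /curvN.
under eq_bigr do rewrite mulrBr.
by rewrite sumrB !E Psym Qsym [W nu mu + _]addrC subrr.
Qed.

(** * Homogeneity along the fibres *)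

(** Symmetry turns y^a (d lambda_{ia} / d y^b) = 0 into y^a (d lambda_{ib} / d y^a) = 0, a vanishing
    radial derivative; the mean value theorem from (x, y) to (x, t y) concludes. *)
Lemma coframe_homogeneous i b : pos_homogeneous A 0 (th i b).
Proof.
move=> x y t Axy t0; rewrite expr0 mul1r.
have radial (s : R) : 0 < s -> 'D_(0, y) (th i b) (x, s *: y) = 0.
  move=> s0; have As := cone _ _ _ Axy s0.
  rewrite (derive_vertical y oA As (coframe_Ck 1 i b)).
  (* The relation at the point (x, s y) concerns the direction s y, hence the multiplication by
     [s]. *)
  apply: (mulfI (lt0r_neq0 s0)); rewrite mulr0 mulr_sumr.
  rewrite -[RHS](y_dy_coframe _ i b As); apply: eq_bigr => a _.
  by rewrite mulrA dy_coframe_symmetric // /yfield /= mxE.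
have line (r : R) : ((x, y) : TMpt R n) + r *: ((0, y) : TMpt R n) = (x, (1 + r) *: y).
  by congr (_, _) => /=; rewrite ?scaler0 ?addr0 // scalerDl scale1r.
(* The factor is a convex combination of 1 and [t], hence positive: the segment stays on the open
   ray and so inside [A], even without the zero section. *)
have pos (s : R) : s \in `[0, 1] -> 0 < 1 + s * (t - 1).
  rewrite in_itv /= => /andP[s0 s1].
  have [t1|t1] := leP 1 t.
    by rewrite ltr_wpDr // mulr_ge0 // subr_ge0.
  have : s * (1 - t) <= 1 * (1 - t) by rewrite ler_wpM2r // subr_ge0 ltW.
  by lra.
have [s s01|s s01] := MVT_direction (th i b) (x, y) (0, y) (t - 1).
  by rewrite line; apply: coframe_derivable; apply: cone => //; exact: pos.
rewrite !line radial ?pos // mulr0 subrKC => /eqP.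
by rewrite subr_eq0 => /eqP.
Qed.

Lemma metric_homogeneous a b : pos_homogeneous A 0 (g a b).
Proof.
move=> x y t Axy t0; rewrite expr0 mul1r; apply: eq_bigr => i _.
by rewrite !coframe_homogeneous // expr0 !mul1r.
Qed.

Lemma lam_homogeneous i a : pos_homogeneous A 0 (lam i a).
Proof.
move=> x y t Axy t0; rewrite expr0 mul1r.
have Aty := cone _ _ _ Axy t0.
suff : \matrix_(j < n, b < n) lam j b (x, t *: y) = \matrix_(j < n, b < n) lam j b (x, y).
  by move=> /matrixP /(_ i a); rewrite !mxE.
rewrite -[LHS]invmxK -[RHS]invmxK; congr invmx; apply/matrixP => b j.
by have := coframe_homogeneous j b _ _ _ Axy t0; rewrite expr0 mul1r.
Qed.

(** In [N_formula] only the factor y^b carries a degree, since derivatives along x keep the degree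
    zero of the coframe. *)
Lemma N_homogeneous a mu : pos_homogeneous A 1 (N a mu).
Proof.
move=> x y t Axy t0; have Aty := cone _ _ _ Axy t0.
rewrite !N_formula // expr1 mulr_sumr; apply: eq_bigr => b _.
rewrite {1}/yfield /= mxE -mulrA; congr (_ * (_ * _)); apply: eq_bigr => i _.
rewrite lam_homogeneous // expr0 mul1r; congr (_ * _).
have := @derive_pos_homogeneous _ _ A 0 (th i b) x y (delta_mx 0 mu) 0 t oA
  (coframe_Ck 1 i b) (coframe_homogeneous i b) Axy Aty t0.
by rewrite scaler0 expr0 mul1r.
Qed.

(** By [dyN_Gam] this is a vertical derivative of a function of degree one. Multiplying by [t] makes
    the direction the dilated one of [derive_pos_homogeneous]. *)
Lemma Gam_homogeneous a b mu : pos_homogeneous A 0 (Gam_v D a b mu).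
Proof.
move=> x y t Axy t0; have Aty := cone _ _ _ Axy t0.
rewrite -!dyN_Gam // expr0 mul1r; apply: (mulfI (lt0r_neq0 t0)).
have := @derive_pos_homogeneous _ _ A 1 (N a mu) x y 0 (delta_mx 0 b) t oA
  (N_Ck 1 a mu) (N_homogeneous a mu) Axy Aty t0.
rewrite expr1 => <-.
have := is_derive_scale (N a mu) (x, t *: y) (0, delta_mx 0 b) t
  (Ck_derivable _ _ _ _ _ (N_Ck 1 a mu) Aty).
have -> : t *: ((0, delta_mx 0 b) : TMpt R n) = (0, t *: delta_mx 0 b).
  by congr (_, _); rewrite /= scaler0.
by case=> _ ->.
Qed.

(** * Comparison with the natural connection *)

(** Once the vertical derivative of N is Gamma, the bracket in the natural coefficient is the
    horizontal covariant derivative of [g]; it vanishes term by term, leaving the derivative of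
    N. *)
Lemma Gam_natural u a b mu : A u -> Gam_v Dn a b mu u = Gam_v D a b mu u.
Proof.
move=> Au; rewrite -dyN_Gam // /= big1 ?mul0r ?addr0 // => c _.
rewrite dadapted_metric //.
have -> : \sum_d g d c u * dy b (N d mu) u =
          \sum_i th i c u * dadapted N mu (th i b) u.
  under eq_bigr do rewrite metric_symmetric.
  rewrite metric_sum; apply: eq_bigr => i _; by rewrite coframe_dyN.
have -> : \sum_d g b d u * dy c (N d mu) u =
          \sum_i th i b u * dadapted N mu (th i c) u.
  rewrite metric_sum; apply: eq_bigr => i _; by rewrite coframe_dyN.
rewrite -!sumrB big1 ?mulr0 // => i _; ring.
Qed.

(** Writing C^a_{bc} as g^{ad} g_{de} C^e_{bc} reduces the claim to lowered indices. There symmetry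
    collapses the Christoffel combination to twice lambda_{id} (d lambda_{ib} / d y^c). *)
Lemma C_natural u a b c : A u -> C_v Dn a b c u = C_v D a b c u.
Proof.
move=> Au; rewrite -[RHS](imetric_metric u a (fun e => C_v D e b c u) Au) /=.
rewrite mulr_suml; apply: eq_bigr => d _; rewrite -mulrA; congr (_ * _).
rewrite (metric_sum u d (fun e => C_v D e b c u)).
under [RHS]eq_bigr do rewrite (coframe_C u _ b c Au).
rewrite !dy_metric // -big_split -sumrB mulr_suml; apply: eq_bigr => i _ /=.
rewrite (dy_coframe_symmetric u i b d Au) (dy_coframe_symmetric u i b c Au).
rewrite (dy_coframe_symmetric u i c d Au).
set p := dy d _ _; set q := dy d _ _; set r := dy c _ _.
have two : (2 : R) != 0 by rewrite pnatr_eq0.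
by apply: (mulIf two); rewrite mulfVK //; ring.
Qed.
End LocalGeometry.

(** * From local identities to the EAP-space *)

Section EAPCharts.
Context {R : realType} {n : nat} {M : smoothManifold R n} {slit : bool}.

Lemma TMdom_cone (c : chart_index M) x y (t : R) :
  TMdom slit c (x, y) -> 0 < t -> TMdom slit c (x, t *: y).
Proof.
move=> [cx yx] t0; split=> //= s /eqP; rewrite scaler_eq0 gt_eqF //= => /eqP.
exact: yx s.
Qed.

Lemma lamv_unit (S : EAPspace M slit) c u : TMdom slit c u ->
  \matrix_(i < n, a < n) lamv S c i a u \in unitmx.
Proof. by move=> cu; rewrite -row_free_unit; exact: lamv_free. Qed.

(* The law of transformation relates values at points [u] and
   [TMtransition c d u]; the latter stays in the domain since the Jacobian is
   injective. *)
Lemma nonlinear_connection_ext (N N' : chart_index M -> 'I_n -> 'I_n -> TMpt R n -> R) :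
  (forall c u, TMdom slit c u -> forall a mu, N c a mu u = N' c a mu u) ->
  nonlinear_connection slit N -> nonlinear_connection slit N'.
Proof.
move=> NN' [Nsmooth Nlaw]; split=> [c a mu k|c d u cdu b mu].
  by apply: Ck_ext (Nsmooth c a mu k) => [|u /NN']; [exact: TMdom_open|].
have dcu := TMtransition_dom _ _ _ _ cdu.
rewrite -(eq_bigr _ (fun nu _ => congr1 ( *%R^~ _) (NN' d _ dcu b nu))).
rewrite (Nlaw c d u cdu b mu); congr (_ - _).
by apply: eq_bigr => a _; rewrite (NN' _ _ cdu.1).
Qed.
End EAPCharts.

Theorem theorem5p3 (R : realType) (n : nat) (M : smoothManifold R n) (slit : bool)
    (S : EAPspace M slit) (hcartan : cartan_type S (Dcan S)) :
  (* (a) *)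
  (nonlinear_connection slit (fun c a mu u =>
     \sum_b yfield b u * \sum_i lamv S c i a u * dx mu (colamv S c i b) u) /\
   forall c u, TMdom slit c u -> forall a mu,
     nlc S c a mu u =
     \sum_b yfield b u * \sum_i lamv S c i a u * dx mu (colamv S c i b) u) /\
  (* (b) *)
  (forall c u, TMdom slit c u ->
     [/\ forall a mu nu, curvN (nlc S c) a mu nu u = 0,
         forall a mu e, Ptor (nlc S c) (Dcan S c) a mu e u = 0
       & forall a b e, Ttor (Dcan S c) a b e u = 0] /\
     [/\ forall a b e, C_v (Dcan S c) a b e u = C_v (Dcan S c) a e b u,
         forall a b e, contortion_v S c a b e u = 0
       & forall a b e,
         [/\ C_v (Dcan S c) a b e u = C_v (Ddual S c) a b e u,
             C_v (Ddual S c) a b e u = C_v (Dsym S c) a b e u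
           & C_v (Dsym S c) a b e u = C_v (Dnat S c) a b e u]]) /\
  (* (c) *)
  (forall c u, TMdom slit c u ->
     [/\ forall i a b,
           [/\ vcov (Ddual S c) (lamv S c i) a b u = 0,
               vcov (Dsym S c) (lamv S c i) a b u = 0
             & vcov (Dnat S c) (lamv S c i) a b u = 0],
         forall a b e,
           [/\ vcov2 (Ddual S c) (gv S c) a b e u = 0,
               vcov2 (Dsym S c) (gv S c) a b e u = 0
             & vcov2 (Dnat S c) (gv S c) a b e u = 0]
       & forall a b,
           [/\ vcov (Ddual S c) yfield a b u = (a == b)%:R,
               vcov (Dsym S c) yfield a b u = (a == b)%:R
             & vcov (Dnat S c) yfield a b u = (a == b)%:R]]) /\
  (* (d) *)
  (forall c,
     (forall i a, pos_homogeneous (TMdom slit c) 0 (colamv S c i a)) /\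
     (forall a b, pos_homogeneous (TMdom slit c) 0 (gv S c a b))) /\
  (* (e) *)
  (forall c,
     [/\ forall u, TMdom slit c u -> forall a b mu,
           dy b (nlc S c a mu) u = Gam_v (Dcan S c) a b mu u,
         forall a mu, pos_homogeneous (TMdom slit c) 1 (nlc S c a mu)
       & forall a b mu,
           pos_homogeneous (TMdom slit c) 0 (Gam_v (Dcan S c) a b mu)]) /\
  (* (f) *)
  (forall c u, TMdom slit c u -> forall a b mu,
     contortion_h S c a b mu u = 0 /\
     Gam_v (Dcan S c) a b mu u = Gam_v (Dnat S c) a b mu u) /\
  (* (g) *)
  (forall c u, TMdom slit c u -> forall a mu b,
     Ptor (nlc S c) (Dnat S c) a mu b u = 0).
Proof.
have Nk c k a mu : Ck_on k (TMdom slit c) (nlc S c a mu) by exact: (nlcP S).1.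
have lk c k i a : Ck_on k (TMdom slit c) (lamv S c i a) by exact: (lamvP S i).1.
have oT c : open (TMdom (M := M) slit c) by exact: TMdom_open.
have lU c := lamv_unit S c.
have ch c u (cu : TMdom slit c u) := (hcartan c u cu).1.
have cv c u (cu : TMdom slit c u) := (hcartan c u cu).2.
have Nform c u : TMdom slit c u -> forall a mu, nlc S c a mu u =
    \sum_b yfield b u * \sum_i lamv S c i a u * dx mu (colamv S c i b) u.
  by move=> cu a mu; exact: N_formula (lU c) (ch c) (cv c) _ _ _ cu.
have Csym c u a b e : TMdom slit c u ->
    C_v (Dcan S c) a b e u = C_v (Dcan S c) a e b u.
  by move=> cu; apply: (C_symmetric (oT c) (lk c) (lU c) (cv c)).
have Cnat c u a b e : TMdom slit c u ->
    C_v (Dnat S c) a b e u = C_v (Dcan S c) a b e u.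
  by move=> cu; apply: (C_natural (oT c) (lk c) (lU c) (cv c)).
have Csm c u a b e : TMdom slit c u ->
    C_v (Dsym S c) a b e u = C_v (Dcan S c) a b e u.
  move=> cu.
  transitivity ((C_v (Dcan S c) a b e u + C_v (Dcan S c) a e b u) / 2) => //.
  by rewrite -Csym // mulrDl -splitr.
have Gnat c u a b mu : TMdom slit c u ->
    Gam_v (Dnat S c) a b mu u = Gam_v (Dcan S c) a b mu u.
  by move=> cu; apply: (Gam_natural (oT c) (Nk c) (lk c) (lU c) (ch c) (cv c)).
have dyN c u a b mu : TMdom slit c u ->
    dy b (nlc S c a mu) u = Gam_v (Dcan S c) a b mu u.
  by move=> cu; apply: (dyN_Gam (oT c) (Nk c) (lk c) (lU c) (ch c) (cv c)).
split.
  split; last exact: Nform.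
  exact: nonlinear_connection_ext Nform (nlcP S).
split.
  move=> c u cu; split; split.
  - by move=> a mu nu; apply: (curvN0 (oT c) (Nk c) (lk c) (lU c) (ch c) (cv c)).
  - by move=> a mu e; rewrite /Ptor dyN // subrr.
  - by move=> a b e; rewrite /Ttor Csym // subrr.
  - by move=> a b e; exact: Csym.
  - by move=> a b e; rewrite /contortion_v Cnat // subrr.
  - move=> a b e; rewrite Csm // Cnat //.
    by split; [exact: Csym|exact: Csym|].
split.
  move=> c u cu.
  (* The vertical derivatives see a connection through [C_v] alone, so the equalities of (b) reduce
     (c) to the canonical connection. *)
  have vcovE (D : dconnection R n) X a b :
      (forall a b e, C_v D a b e u = C_v (Dcan S c) a b e u) ->
      vcov D X a b u = vcov (Dcan S c) X a b u.
    by move=> DC; congr (_ + _); apply: eq_bigr => d _; rewrite DC.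
  have vcov2E (D : dconnection R n) a b e :
      (forall a b e, C_v D a b e u = C_v (Dcan S c) a b e u) ->
      vcov2 D (gv S c) a b e u = 0.
    have g0 : vcov2 (Dcan S c) (gv S c) a b e u = 0.
      exact: (metric_parallel (oT c) (lk c) (lU c)).
    move=> DC; rewrite -[RHS]g0.
    by congr (_ - _ - _); apply: eq_bigr => d _; rewrite DC.
  have Cd a b e : C_v (Ddual S c) a b e u = C_v (Dcan S c) a b e u.
    exact: Csym.
  have lam0 i a b : vcov (Dcan S c) (lamv S c i) a b u = 0.
    exact: (lam_parallel (oT c) (lk c) (lU c)).
  split=> [i a b|a b e|a b].
  - by split; rewrite vcovE // => *; [exact: Csm|exact: Cnat].
  - by split; apply: vcov2E => *; [exact: Cd|exact: Csm|exact: Cnat].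
  - by split; rewrite vcovE ?cv // => *; [exact: Csm|exact: Cnat].
split.
  move=> c; split=> [i a|a b].
    exact: (coframe_homogeneous (oT c) (TMdom_cone c) (lk c) (lU c) (cv c)).
  exact: (metric_homogeneous (oT c) (TMdom_cone c) (lk c) (lU c) (cv c)).
split.
  move=> c; split=> [u cu a b mu|a mu|a b mu]; first exact: dyN.
    exact: (N_homogeneous (oT c) (TMdom_cone c) (lk c) (lU c) (ch c) (cv c)).
  exact: (Gam_homogeneous (oT c) (TMdom_cone c) (Nk c) (lk c) (lU c) (ch c) (cv c)).
split=> c u cu a b mu.
  by rewrite /contortion_h Gnat // subrr.
by rewrite /Ptor dyN // Gnat // subrr.
Qed.
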